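(* Let $p$ be an odd prime, $e$ a positive integer, $q=p^e$ and $Q=q^2$. Let $T\in\mathbb{F}_Q[X,Y,Z]$ be the polynomial defined by $$T(X,Y,Z) = M(X,Y) + Z - \sum_{i=0}^{q-2}g_i(X)\,t_q(Y)^{i+1}\,t_q(Z)^{q-(i+1)},$$ where $$M(X,Y)=XY-2^{-1}t_{(Q+1)/2}(X)\,t_q(Y)$$ and $$g_i(X) = (-4)^{-(i+1)}\sum_{j=0}^{i+1} C[j(q-1)+i]\,X^{j(q-1)+i+1}.$$ Here $C[n]$ is the $n$-th Catalan number and $t_n(X)=X^n-X$. Then $T$ is a reduced PTR polynomial for the Hughes plane of order $Q$ defined over the regular nearfield.
   Context: $\mathbb{F}_Q$ is the finite field with $Q$ elements and $\mathbb{F}_q$ its subfield with $q$ elements. $C[n]=\frac{1}{n+1}\binom{2n}{n}$; integers (and inverses of integers prime to $p$) are read in $\mathbb{F}_p\subset\mathbb{F}_Q$ when used as coefficients. A polynomial in $\mathbb{F}_Q[X,Y,Z]$ is reduced if its degree in each of $X,Y,Z$ is less than $Q$. A function $\tau:\mathbb{F}_Q^3\to\mathbb{F}_Q$ is a planar ternary ring (PTR) if: (A) $\tau(a,0,z)=\tau(0,b,z)=z$ for all $a,b,z$; (B) $\tau(x,1,0)=x$ and $\tau(1,y,0)=y$ for all $x,y$; (C) if $a\neq c$, then for all $b,d$ there is a unique $x$ with $\tau(x,a,b)=\tau(x,c,d)$; (D) for all $a,b,c$ there is a unique $z$ with $\tau(a,b,z)=c$; (E) if $a\ne c$, then for all $b,d$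 there is a unique pair $(y,z)$ with $\tau(a,y,z)=b$ and $\tau(c,y,z)=d$. A PTR polynomial is a polynomial in $\mathbb{F}_Q[X,Y,Z]$ whose evaluation function is a PTR. By Hall, a PTR $\tau$ on $\mathbb{F}_Q$ is equivalent to a projective plane of order $Q$, the plane it coordinatises: points $(x,y)$, $(m)$, $(\infty)$ with $x,y,m\in\mathbb{F}_Q$; lines $\{(x,\tau(x,m,k)):x\in\mathbb{F}_Q\}\cup\{(m)\}$ for $m,k\in\mathbb{F}_Q$, $\{(c,y):y\in\mathbb{F}_Q\}\cup\{(\infty)\}$ for $c\in\mathbb{F}_Q$, and $\{(m):m\in\mathbb{F}_Q\}\cup\{(\infty)\}$. The regular nearfield of order $Q$ with center $\mathbb{F}_q$ is $(\mathbb{F}_Q,+,\star)$ with $x\star y=xy$ if $x$ is a square in $\mathbb{F}_Q$ and $x\star y=xy^q$ if $x$ is a non-square in $\mathbb{F}_Q$. The Hughes plane of order $Q$ over it is the projective plane coordinatised by the following PTR (Dembowski's description): $\tau(x,y,z)=x\star y+z$ if $y\in\mathbb{F}_q$, and $\tau(x,y,z)=(x+k)\star y+k'$ if $y\notin\mathbb{F}_q$, where $(k,k')\in\mathbb{F}_q\times\mathbb{F}_q$ is the unique pair with $z=ky+k'$. A PTR polynomial for the Hughes plane is a PTR polynomial whose induced PTR coordinatises the Hughes plane. *)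

(* Defs.v *)
From HB Require Import structures.
From mathcomp Require Import all_boot all_order all_algebra.
From mathcomp Require Import mpoly.

Set Implicit Arguments.
Unset Strict Implicit.
Unset Printing Implicit Defensive.

Import GRing.Theory.
Local Open Scope ring_scope.

Definition is_ptr (F : finFieldType) (tau : F -> F -> F -> F) : Prop :=
  [/\ (forall a b z, tau a 0 z = z /\ tau 0 b z = z),
      (forall x y, tau x 1 0 = x /\ tau 1 y 0 = y),
      (forall a c, a <> c -> forall b d, exists! x, tau x a b = tau x c d),
      (forall a b c, exists! z, tau a b z = c)
    & (forall a c, a <> c -> forall b d,
         exists! yz : F * F, tau a yz.1 yz.2 = b /\ tau c yz.1 yz.2 = d)].

(* inl (x, y) is the affine point (x, y); inr (Some m) is the point (m) at
   infinity, and inr None is the point (oo). *)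
Definition point (F : finFieldType) : finType := ((F * F) + option F)%type.

Definition affine_pt (F : finFieldType) (x y : F) : point F := inl (x, y).
Definition slope_pt (F : finFieldType) (m : F) : point F := inr (Some m).
Definition infty_pt (F : finFieldType) : point F := inr None.

Definition slope_line (F : finFieldType) (tau : F -> F -> F -> F) (m k : F) :
    {set point F} :=
  slope_pt m |: [set affine_pt x (tau x m k) | x : F].

Definition vertical_line (F : finFieldType) (c : F) : {set point F} :=
  infty_pt F |: [set affine_pt c y | y : F].

Definition infty_line (F : finFieldType) : {set point F} :=
  infty_pt F |: [set slope_pt m | m : F].

Definition ptr_lines (F : finFieldType) (tau : F -> F -> F -> F) :
    {set {set point F}} :=
  infty_line F |:
    ([set slope_line tau mk.1 mk.2 | mk : F * F]
     :|: [set vertical_line c | c : F]).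

(* A plane is given by its finite set P of points and its set of lines, each
   line being a set of points; planes are compared up to isomorphism. *)
Definition coordinatises (F : finFieldType) (tau : F -> F -> F -> F)
    (P : finType) (lines : {set {set P}}) : Prop :=
  exists f : point F -> P,
    bijective f /\ lines = [set f @: (l : {set point F}) | l in ptr_lines tau].

Definition nearfield_mul (F : finFieldType) (q : nat) (x y : F) : F :=
  if [exists w : F, x == w ^+ 2] then x * y else x * y ^+ q.

(* K is the subfield with q elements.  When #|F| = q ^ 2 and y \notin K, the
   pair (k, k') below exists and is unique, so the None case is never reached. *)
Definition hughes_ptr (F : finFieldType) (q : nat) (K : {set F}) (x y z : F) :
    F :=
  if y \in K then nearfield_mul q x y + z
  else if [pick kk : F * F | [&& kk.1 \in K, kk.2 \in K
                                & z == kk.1 * y + kk.2]] is Some (k, k')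
  then nearfield_mul q (x + k) y + k'
  else 0.

Definition hughes_lines (F : finFieldType) (q : nat) (K : {set F}) :
    {set {set point F}} :=
  ptr_lines (hughes_ptr q K).

(* In {mpoly F[3]} the variables X, Y, Z have indices 0, 1, 2. *)
Definition eval3 (F : finFieldType) (T : {mpoly F[3]}) (x y z : F) : F :=
  T.@[tnth [tuple x; y; z]].

Definition is_reduced (F : finFieldType) (T : {mpoly F[3]}) : Prop :=
  forall m, m \in msupp T -> forall i : 'I_3, (m i < #|F|)%N.

Definition is_ptr_poly (F : finFieldType) (T : {mpoly F[3]}) : Prop :=
  is_ptr (eval3 T).

Definition is_hughes_ptr_poly (F : finFieldType) (q : nat) (K : {set F})
    (T : {mpoly F[3]}) : Prop :=
  is_ptr_poly T /\ coordinatises (eval3 T) (hughes_lines q K).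

(* The division is exact. *)
Definition catalan (n : nat) : nat := ('C(2 * n, n) %/ n.+1)%N.

Definition t_poly (R : nzRingType) (n : nat) (P : R) : R := P ^+ n - P.

Definition varX (F : finFieldType) : {mpoly F[3]} := 'X_(inord 0).
Definition varY (F : finFieldType) : {mpoly F[3]} := 'X_(inord 1).
Definition varZ (F : finFieldType) : {mpoly F[3]} := 'X_(inord 2).

Definition M_poly (F : finFieldType) (q : nat) : {mpoly F[3]} :=
  varX F * varY F
  - (2%:R : F)^-1 *: (t_poly ((q ^ 2 + 1) %/ 2) (varX F) * t_poly q (varY F)).

Definition g_poly (F : finFieldType) (q i : nat) : {mpoly F[3]} :=
  (- 4%:R : F) ^- i.+1 *:
    \sum_(0 <= j < i.+2)
      (catalan (j * (q - 1) + i))%:R *: varX F ^+ (j * (q - 1) + i + 1).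

Definition T_poly (F : finFieldType) (q : nat) : {mpoly F[3]} :=
  M_poly F q + varZ F
  - \sum_(0 <= i < q - 1)
      g_poly F q i * t_poly q (varY F) ^+ i.+1
                   * t_poly q (varZ F) ^+ (q - i.+1).

(* Main.v *)
Require Import Defs.
From mathcomp Require Import all_boot all_order all_algebra.
From mathcomp Require Import mpoly.
From mathcomp Require Import all_solvable all_field zify ring.

(** T is in fact the Hughes ternary operation itself, as a function.  For y
   outside K write z = k y + k' with k, k' in K; then t_q(z) = k t_q(y) and
   t_q(y)^q = - t_q(y), so with h = (Q + 1) / 2 the claim becomes
     sum_i g_i(x) k^(q-1-i) = - ((x + k)^h - x^h - k) / 2,
   because (v - v^h) / 2 is v for a non-square v and 0 otherwise.  Expanding
   (x + k)^h and reducing the exponents of k modulo q - 1, this compares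
   coefficients: modulo p one has 'C(h, n) = 'C(1/2, n) for n < Q, and 'C(1/2, s+1)
   is a Catalan number up to a power of -4 (both being coefficients of a square
   root of 1 - 4 X), while the terms present on one side only vanish by Lucas.
   That the Hughes operation is a PTR follows from a computation with the
   quadratic character: two lines have at most one common affine point. *)

Set Implicit Arguments.
Unset Strict Implicit.
Unset Printing Implicit Defensive.

Import GRing.Theory.
Local Open Scope ring_scope.

(** * Catalan numbers and binomial coefficients modulo p *)

(** The division is exact with quotient ['C(2n, n) - 'C(2n, n+1)], because
    [(n+1) 'C(2n, n+1) = n 'C(2n, n)]. *)
Lemma mul_catalan n : (n.+1 * catalan n = 'C(2 * n, n))%N.
Proof.
rewrite /catalan mulnC divnK //.
have le : ('C(2 * n, n.+1) <= 'C(2 * n, n))%N.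
  have := mul_bin_left (2 * n) n; nia.
apply/dvdnP; exists ('C(2 * n, n) - 'C(2 * n, n.+1))%N.
have := mul_bin_left (2 * n) n; nia.
Qed.

Lemma catalanS s : (s.+2 * catalan s.+1 = 2 * (2 * s + 1) * catalan s)%N.
Proof.
have h0 := mul_catalan s; have h1 := mul_catalan s.+1.
have h2 := mul_bin_diag (2 * s).+2 s.
have h3 := mul_bin_left (2 * s).+1 s.
have h4 := mul_bin_diag (2 * s).+1 s.
have h5 := mul_bin_left (2 * s) s.
rewrite /= in h2 h4.
have e : (2 * s.+1 = (2 * s).+2)%N by lia.
rewrite e in h1.
nia.
Qed.

(* The coefficients of the power series (1 - 4 X)^(1/2). *)
Definition sqrt_coef (n : nat) : int :=
  if n is s.+1 then - (catalan s)%:Z *+ 2 else 1.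

(** This is the differential equation [(1 - 4 X) f' = - 2 f] of [f = (1 - 4 X)^(1/2)], read on
    coefficients. *)
Lemma sqrt_coefS n :
  n.+1%:Z * sqrt_coef n.+1 = (n%:Z *+ 4 - 2) * sqrt_coef n.
Proof.
case: n => [|s] /=; first by [].
have := catalanS s; nia.
Qed.

(** The coefficients [d] of the squared series satisfy a first-order recurrence whose factor
    [4 m - 4] vanishes at [m = 1], so [d] is zero from degree 2 on. *)
Lemma sqrt_coef_conv n :
  \sum_(k < n.+1) sqrt_coef k * sqrt_coef (n - k) =
  [:: 1; - 4%:R]`_n.
Proof.
pose d n := \sum_(k < n.+1) sqrt_coef k * sqrt_coef (n - k).
have rec m : m.+1%:Z * d m.+1 = (m%:Z *+ 4 - 4%:R) * d m.
  have sym (a : nat -> int) N :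
      \sum_(k < N.+1) a k = \sum_(k < N.+1) a (N - k)%N.
    by rewrite (reindex_inj rev_ord_inj); apply: eq_bigr => k _; rewrite /= subSS.
  (* Splitting [m + 1] as [k + (m + 1 - k)] and reversing one half of the sum turns the weight into
     [2 k], to which [sqrt_coefS] applies. *)
  have E1 : m.+1%:Z * d m.+1 =
     (\sum_(k < m.+2) k%:Z * sqrt_coef k * sqrt_coef (m.+1 - k)) *+ 2.
    rewrite mulr2n {2}(sym (fun k => k%:Z * sqrt_coef k * sqrt_coef (m.+1 - k))).
    rewrite -big_split mulr_sumr; apply: eq_bigr => k _ /=.
    have lk : (k <= m.+1)%N by rewrite -ltnS.
    rewrite subKn //.
    have -> : m.+1%:Z = k%:Z + (m.+1 - k)%N%:Z by lia.
    ring.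
  have E2 : (m%:Z *+ 4 - 4%:R) * d m =
     (\sum_(k < m.+1) (k%:Z *+ 4 - 2) * sqrt_coef k * sqrt_coef (m - k)) *+ 2.
    rewrite mulr2n {2}(sym (fun k =>
      (k%:Z *+ 4 - 2) * sqrt_coef k * sqrt_coef (m - k))).
    rewrite -big_split mulr_sumr; apply: eq_bigr => k _ /=.
    have lk : (k <= m)%N by rewrite -ltnS.
    rewrite subKn //.
    have -> : m%:Z = k%:Z + (m - k)%N%:Z by lia.
    ring.
  rewrite E1 E2 big_ord_recl !mul0r add0r; congr (_ *+ 2).
  apply: eq_bigr => k _; rewrite /= subSS.
  by rewrite sqrt_coefS.
rewrite -/(d n).
have d0 : d 0%N = 1 by rewrite /d big_ord1.
have d1 : d 1%N = - 4%:R by rewrite /d !big_ord_recl big_ord0.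
elim: n => [|[|n] IH]; rewrite ?d0 ?d1 //.
have := rec n.+1; rewrite IH; case: n {IH} => [|n].
  by rewrite /=; lia.
rewrite ![nth _ _ _]nth_default // mulr0 => /eqP;
  rewrite mulf_eq0 => /orP[/eqP|/eqP //]; lia.
Qed.

(** In [n 'C(m p^a, n) = m p^a 'C(m p^a - 1, n - 1)], a binomial coefficient prime to [p] leaves all
    of [p^a] in [n]. *)
Lemma dvdn_bin_mul_pexp p a m n :
  prime p -> ~~ (p %| 'C(m * p ^ a, n))%N -> (p ^ a %| n)%N.
Proof.
move=> pp; case: n => [|n] // nd.
have := mul_bin_diag (m * p ^ a) n => e.
have : (p ^ a %| n.+1 * 'C(m * p ^ a, n.+1))%N.
  by rewrite -e -mulnA dvdn_mull // dvdn_mulr.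
rewrite Gauss_dvdl // coprimeXl //.
by rewrite prime_coprime.
Qed.

Lemma natr2_neq0 (F : idomainType) p : p \in [pchar F] -> odd p -> 2%:R != 0 :> F.
Proof.
move=> pF; apply: contraL; rewrite -(dvdn_pcharf pF) => /dvdn_leq h2.
have := h2 isT; have := prime_gt1 (pcharf_prime pF) => ? ?.
by have -> : p = 2%N by lia.
Qed.

(* Both sides are the coefficients of square roots of 1 - 4 X modulo X^(p^a):
   on the left because (1 - 4 X)^(2 h) = (1 - 4 X) (1 - (4 X)^(p^a)). *)
Lemma half_bin_catalan (F : fieldType) (p a h s : nat) :
  p \in [pchar F] -> odd p -> (2 * h = (p ^ a).+1)%N -> (s.+1 < p ^ a)%N ->
  (- 4%:R) ^+ s.+1 * 'C(h, s.+1)%:R = - (catalan s)%:R *+ 2 :> F.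
Proof.
move=> pF op eh lts.
have pp := pcharf_prime pF.
have n2 := natr2_neq0 pF op.
pose x n : F := (- 4%:R) ^+ n * 'C(h, n)%:R.
pose y n : F := (sqrt_coef n)%:~R.
(* With [u 0 = 1] and 2 invertible, the squared series determines [u (n + 2)] from the earlier
   coefficients. *)
have conv (u : nat -> F) n : \sum_(k < n.+3) u k * u (n.+2 - k)%N =
   u 0%N * u n.+2 *+ 2 + \sum_(k < n.+1) u k.+1 * u (n.+1 - k)%N.
  rewrite big_ord_recl big_ord_recr /= subn0 subnn.
  rewrite (mulrC (u n.+2)) (addrC (\sum_(_ < _) _)) addrA -mulr2n.
  by congr (_ + _); apply: eq_bigr => k _; rewrite /= subSS.
have convx n : (n.+2 < p ^ a)%N -> \sum_(k < n.+3) x k * x (n.+2 - k)%N = 0.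
  move=> ln.
  have -> : \sum_(k < n.+3) x k * x (n.+2 - k)%N =
     (- 4%:R) ^+ n.+2 * 'C((p ^ a).+1, n.+2)%:R.
    have -> : (p ^ a).+1 = (h + h)%N by lia.
    rewrite -binomial.Vandermonde natr_sum mulr_sumr; apply: eq_bigr => k _.
    rewrite /x mulrACA -exprD natrM subnKC //.
    by rewrite -ltnS.
  rewrite binS natrD.
  have z i : (0 < i < p ^ a)%N -> 'C(p ^ a, i)%:R = 0 :> F.
    move=> /andP[i0 ilt]; apply/eqP; rewrite -(dvdn_pcharf pF).
    apply: contraT; rewrite -[X in 'C(X, _)]mul1n => /(dvdn_bin_mul_pexp pp).
    by move/dvdn_leq => /(_ i0); rewrite leqNgt ilt.
  by rewrite !z ?addr0 ?mulr0 //; lia.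
have convy n : \sum_(k < n.+3) y k * y (n.+2 - k)%N = 0.
  have := sqrt_coef_conv n.+2;
    rewrite nth_default // => /(congr1 (fun z => z%:~R : F)).
  rewrite rmorph_sum rmorph0 => e; apply: etrans e.
  by apply: eq_bigr => k _; rewrite /y rmorphM.
have x0 : x 0%N = 1 by rewrite /x bin0 mulr1.
have y0 : y 0%N = 1 by [].
have x1 : x 1%N = y 1%N.
  have c1 : sqrt_coef 1 = - 2%:R by [].
  rewrite /x /y c1 expr1 bin1 rmorphN rmorph_nat.
  have : (2 * h)%:R = 1 + (p ^ a)%:R :> F by rewrite eh mulrS.
  have -> : (p ^ a)%:R = 0 :> F.
    by case: (a) lts => [//|b _]; rewrite expnS natrM (pcharf0 pF) mul0r.
  rewrite addr0 natrM => e.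
  transitivity (- 2%:R * (2%:R * h%:R : F)); first by ring.
  by rewrite e mulr1.
have main n : (n < p ^ a)%N -> x n = y n.
  have [m] := ubnP n; elim: m n => // m IH [|[|n]] nm ln; rewrite ?x0 ?y0 //.
  have := convx n ln; have := convy n; rewrite !conv x0 y0 !mul1r.
  have -> : \sum_(k < n.+1) x k.+1 * x (n.+1 - k)%N =
            \sum_(k < n.+1) y k.+1 * y (n.+1 - k)%N.
    apply: eq_bigr => k _; have := ltn_ord k => lk.
    rewrite !IH //; lia.
  move=> ey ex; have e := etrans ex (esym ey); apply/eqP; rewrite -subr_eq0.
  have : (x n.+2 - y n.+2) * 2%:R == 0.
    rewrite mulr_natr mulrnBl subr_eq0.
    by apply/eqP; move: e; set S := \sum_(_ < _) _; apply: addIr.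
  by rewrite mulf_eq0 (negPf n2) orbF.
rewrite -[LHS]/(x s.+1) main //; rewrite /y /=.
by rewrite rmorphMn rmorphN /= .
Qed.

(* A case of Lucas' theorem. *)
Lemma dvdn_bin_digit p a m w u v : prime p -> (w < v < p ^ a)%N ->
  (p %| 'C(m * p ^ a + w, u * p ^ a + v))%N.
Proof.
(* In Vandermonde's sum ['C(m p^a, i)] survives modulo [p] only for [i = t p^a]; then [t <= u], and
   the other factor is ['C(w, (u - t) p^a + v)], which is 0 as [w < v]. *)
move=> pp /andP[wv va]; rewrite -binomial.Vandermonde; apply: dvdn_sum => i _.
have [pd|pnd] := boolP (p %| 'C(m * p ^ a, i))%N; first by rewrite dvdn_mulr.
have /dvdnP[t et] := dvdn_bin_mul_pexp pp pnd.
have := ltn_ord i; rewrite ltnS et => le_i.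
have tu : (t <= u)%N by nia.
rewrite (@bin_small w) ?muln0 //; nia.
Qed.

(** * Comparing coefficients of powers of k *)

Lemma expf_fixed_mod (R : pzRingType) (q n m : nat) (k : R) :
  k ^+ q.+1 = k -> (0 < m)%N -> k ^+ (n * q + m) = k ^+ m.
Proof.
move=> kq; case: m => // m _; elim: n => // n IH.
have -> : (n.+1 * q + m.+1 = q.+1 + (n * q + m))%N by lia.
by rewrite exprD kq -exprS -addnS IH.
Qed.

Lemma expf_natr_pchar (R : comNzRingType) (p a n : nat) :
  p \in [pchar R] -> n%:R ^+ (p ^ a) = n%:R :> R.
Proof.
move=> pR; elim: a => // a IH.
by rewrite expnSr exprM IH -(pFrobenius_autE pR) pFrobenius_aut_nat.
Qed.

(** Here [q] stands for one less than the order of the subfield. An inner term of the expansion has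
    [x] to an exponent [j q + i + 1], which leaves [k] with exponent [(r - j) q + (q - i)], and this
    reduces to [q - i]. *)
Lemma sum_bin_shift (F : fieldType) (q r : nat) (x k : F) :
  let h := (r.+1 * q).+1 in (0 < q)%N -> k ^+ q.+1 = k ->
  \sum_(0 <= i < q)
    (\sum_(0 <= j < r.+1) 'C(h, j * q + i + 1)%:R * x ^+ (j * q + i + 1))
      * k ^+ (q - i)
  = (x + k) ^+ h - x ^+ h - k.
Proof.
move=> h q0 kq.
have kh : k ^+ h = k by rewrite /h -addn1 expf_fixed_mod.
rewrite (addrC x) exprDn big_ord_recl big_ord_recr /=.
rewrite subn0 kh expr0 mulr1 bin0 subnn expr0 mul1r binn !mulr1n.
have -> (S : F) : k + (S + x ^+ h) - x ^+ h - k = S by ring.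
rewrite -(big_mkord xpredT (fun i =>
  k ^+ (h - bump 0 i) * x ^+ bump 0 i *+ 'C(h, bump 0 i))).
rewrite big_nat_mul; under eq_bigr do rewrite mulr_suml.
rewrite exchange_big_nat /=; apply: eq_big_nat => j /andP[_ jr].
rewrite -[in RHS](add0n (j * q)%N) big_addn mulSn addnK.
apply: eq_big_nat => i /andP[_ iq].
have -> : bump 0 (i + j * q) = (j * q + i + 1)%N by rewrite /bump; lia.
rewrite -[RHS]mulr_natl -mulrA; congr (_ * _); rewrite mulrC; congr (_ * _).
have -> : (h - (j * q + i + 1) = (r - j) * q + (q - i))%N by nia.
by rewrite expf_fixed_mod // subn_gt0.
Qed.

Section Coefficients.

Variables (F : fieldType) (p e q r i : nat).
Hypotheses (pF : p \in [pchar F]) (op : odd p).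
Hypotheses (qE : q = (p ^ e)%N) (qr : q = r.*2.+1) (iq : (i < q - 1)%N).
(** Since [q = 2 r + 1], this is [(q^2 + 1) / 2], written to expose the period [q - 1] of
    exponents. *)
Let h := (r.+1 * (q - 1)).+1.

(** [half_bin_catalan] applies with [p^a = Q], and [(-4)^q = -4] reduces the power of [-4] to the
    exponent [i + 1]. *)
Lemma catalan_coef_half_bin (j : nat) : (j < i.+2)%N ->
  (- 4%:R) ^- i.+1 * (catalan (j * (q - 1) + i))%:R
  = - 2%:R^-1 * 'C(h, j * (q - 1) + i + 1)%:R :> F.
Proof.
move=> ji; have n2 := natr2_neq0 pF op.
have n4 : - 4%:R != 0 :> F by rewrite oppr_eq0 (natrM _ 2 2) mulf_neq0.
have eh : (2 * h = (p ^ (e + e)).+1)%N by rewrite expnD -qE /h; nia.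
have lt : ((j * (q - 1) + i).+1 < p ^ (e + e))%N by rewrite expnD -qE; nia.
have := half_bin_catalan pF op eh lt.
have q4 : (- 4%:R) ^+ (q - 1).+1 = - 4%:R :> F.
  have -> : (q - 1).+1 = q by lia.
  rewrite exprNn {2}qE expf_natr_pchar // -signr_odd qr /= odd_double expr1.
  by rewrite mulN1r.
rewrite -addnS expf_fixed_mod // addn1 -addnS => E.
have -> : (catalan (j * (q - 1) + i))%:R =
          - 2%:R^-1 * ((- 4%:R) ^+ i.+1 * 'C(h, j * (q - 1) + i.+1)%:R) :> F.
  by rewrite E; field.
rewrite mulrCA; congr (_ * _); rewrite mulrA mulVf ?mul1r //.
by rewrite expf_neq0.
Qed.

(** For [r < j <= i + 1] the lower index exceeds [h]. For [i + 1 < j <= r] the base [q] digits of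
    [h] are [r] and [r + 1], and the low digit [q - j + i + 1] of the lower index is larger than
    [r + 1]. *)
Lemma half_bin_eq0 (j : nat) : (i.+1 < j <= r)%N \/ (r < j <= i.+1)%N ->
  'C(h, j * (q - 1) + i + 1)%:R = 0 :> F.
Proof.
case=> [/andP[ij jr]|/andP[rj ji]]; last by rewrite bin_small // /h; nia.
apply/eqP; rewrite -(dvdn_pcharf pF).
have -> : h = (r * q + r.+1)%N by rewrite /h; nia.
have -> : (j * (q - 1) + i + 1 = j.-1 * q + (q - j + i.+1))%N by nia.
rewrite {1 2}qE; apply: dvdn_bin_digit; first exact: pcharf_prime pF.
rewrite -qE; lia.
Qed.

Lemma sum_catalan_half_bin (x : F) :
  (- 4%:R) ^- i.+1 *
    (\sum_(0 <= j < i.+2)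
      (catalan (j * (q - 1) + i))%:R * x ^+ (j * (q - 1) + i + 1))
  = - 2%:R^-1 * \sum_(0 <= j < r.+1)
      'C(h, j * (q - 1) + i + 1)%:R * x ^+ (j * (q - 1) + i + 1).
Proof.
pose f j := 'C(h, j * (q - 1) + i + 1)%:R * x ^+ (j * (q - 1) + i + 1).
have f0 j : (i.+1 < j <= r)%N \/ (r < j <= i.+1)%N -> f j = 0.
  by move=> ij; rewrite /f half_bin_eq0 ?mul0r.
transitivity (- 2%:R^-1 * \sum_(0 <= j < i.+2) f j).
  rewrite !mulr_sumr; apply: eq_big_nat => j /andP[_ ji].
  by rewrite !mulrA catalan_coef_half_bin.
have z a b : (forall j, (a <= j < b)%N -> f j = 0) -> \sum_(a <= j < b) f j = 0.
  by move=> fz; rewrite big_nat big1.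
congr (_ * _); rewrite -/f; have [le|lt] := leqP i.+2 r.+1.
  rewrite [RHS](big_cat_nat _ le) //= [X in _ + X]z ?addr0 // => j /andP[ij jr].
  by apply: f0; left; rewrite ij.
rewrite (big_cat_nat _ (ltnW lt)) //= [X in _ + X]z ?addr0 // => j /andP[ij jr].
by apply: f0; right; rewrite ij.
Qed.

End Coefficients.

(** * The quadratic character of a finite field *)

Section QuadraticCharacter.

Variables (F : finFieldType) (m : nat).
Hypotheses (n2 : 2%:R != 0 :> F) (cF : #|F| = m.*2.+1).

(** The test made by [nearfield_mul]; zero counts as a square. *)
Definition is_sq (x : F) : bool := [exists w : F, x == w ^+ 2].

Let N1 : -1 != 1 :> F.
Proof.
apply: contra n2 => /eqP e; rewrite -[2%:R]/(1 + 1 : F) -{1}e.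
by rewrite addNr.
Qed.

Let m_gt0 : (0 < m)%N.
Proof. by have := finNzRing_gt1 F; rewrite cF; case: (m). Qed.

Lemma expf_card1 (x : F) : x != 0 -> x ^+ m.*2 = 1.
Proof.
move=> x0; have := expf_card x; rewrite cF exprS -[RHS]mulr1.
exact: mulfI.
Qed.

(** Euler's criterion, with [!= -1] instead of [== 1] so that it also covers [x = 0]. *)
Lemma is_sqE (x : F) : is_sq x = (x ^+ m != -1).
Proof.
have [->|x0] := eqVneq x 0.
  rewrite expr0n eqn0Ngt m_gt0 /= eq_sym oppr_eq0 oner_eq0.
  by apply/existsP; exists 0; rewrite expr0n.
have x2 : (x ^+ m == 1) || (x ^+ m == -1).
  rewrite -subr_eq0 -[X in _ || X]subr_eq0 opprK -mulf_eq0 -subr_sqr expr1n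
    subr_eq0.
  by rewrite -exprM muln2 expf_card1.
apply/existsP/idP => [[w /eqP xw]|xm].
  have w0 : w != 0 by apply: contraNneq x0 => w0; rewrite xw w0 expr0n.
  by rewrite xw -exprM mul2n expf_card1 // eq_sym.
rewrite (negPf xm) orbF in x2.
(* The nonzero elements are powers of a primitive root [z]; if [x = z^i] and [x^m = 1], then [2 m]
   divides [i m], so [i] is even. *)
have unity : all m.*2.-unity_root (enum (predC1 (0 : F))).
  by apply/allP => z; rewrite mem_enum => z0; apply/unity_rootP/expf_card1.
have [||z _ pz] := hasP (has_prim_root _ unity (enum_uniq _) _).
- by rewrite double_gt0.
- by rewrite -cardE cardC1 cF.
have [[i /= _] xi] := prim_rootP pz (expf_card1 x0).
have : (m.*2 %| i * m)%N by rewrite (prim_order_dvd pz) exprM -xi.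
rewrite -mul2n dvdn_pmul2r // => /dvdnP[j ij].
by exists (z ^+ j); rewrite xi ij exprM.
Qed.

Lemma expf_half (x : F) : x != 0 -> x ^+ m = if is_sq x then 1 else -1.
Proof.
move=> x0; rewrite is_sqE; case: eqP => //= xm.
have : (x ^+ m) ^+ 2 == 1 by rewrite -exprM muln2 expf_card1.
by rewrite sqrf_eq1 => /orP[] /eqP.
Qed.

Lemma expf_half_succ (x : F) : x ^+ m.+1 = if is_sq x then x else - x.
Proof.
have [->|x0] := eqVneq x 0; first by rewrite expr0n oppr0 if_same.
by rewrite exprS expf_half //; case: ifP; rewrite ?mulr1 ?mulrN1.
Qed.

Lemma is_sqM (x y : F) : x != 0 -> y != 0 ->
  is_sq (x * y) = (is_sq x == is_sq y).
Proof.
move=> x0 y0; rewrite is_sqE exprMn !expf_half //.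
by do 2 case: ifP => _; rewrite ?mul1r ?mulrNN ?mulr1 ?eqxx // eq_sym.
Qed.

Lemma is_sq0 : is_sq 0.
Proof. by apply/existsP; exists 0; rewrite expr0n. Qed.

Lemma is_sq_expf_odd (x : F) q : odd q -> is_sq (x ^+ q) = is_sq x.
Proof.
have [->|x0] := eqVneq x 0 => qo.
  by rewrite expr0n; case: (q) qo => [|?] //; rewrite is_sq0.
rewrite is_sqE -exprM mulnC exprM expf_half //; case: ifP => _.
  by rewrite expr1n eq_sym.
by rewrite -signr_odd qo expr1 eqxx.
Qed.

End QuadraticCharacter.

(** * The polynomial T *)

Section DegreeBound.

Variables (n : nat) (R : nzRingType) (i : 'I_n).
Implicit Types (P Q : {mpoly R[n]}) (d : nat).

Definition mdeg_in_le d P := forall m, m \in msupp P -> (m i <= d)%N.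

Lemma mdeg_in_leW d1 d2 P :
  mdeg_in_le d1 P -> (d1 <= d2)%N -> mdeg_in_le d2 P.
Proof. by move=> h1 le m /h1 h; apply: leq_trans le. Qed.

Lemma mdeg_in_leD d P Q :
  mdeg_in_le d P -> mdeg_in_le d Q -> mdeg_in_le d (P + Q).
Proof.
by move=> hP hQ m /msuppD_le; rewrite mem_cat => /orP[/hP|/hQ].
Qed.

Lemma mdeg_in_leN d P : mdeg_in_le d P -> mdeg_in_le d (- P).
Proof. by move=> hP m; rewrite (perm_mem (msuppN _)); apply: hP. Qed.

Lemma mdeg_in_leZ d c P : mdeg_in_le d P -> mdeg_in_le d (c *: P).
Proof. by move=> hP m /msuppZ_le; apply: hP. Qed.

Lemma mdeg_in_leM d1 d2 P Q :
  mdeg_in_le d1 P -> mdeg_in_le d2 Q -> mdeg_in_le (d1 + d2)%N (P * Q).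
Proof.
move=> hP hQ m /msuppM_le /allpairsP[[m1 m2] [/= /hP h1 /hQ h2 ->]].
by rewrite mnmDE leq_add.
Qed.

Lemma mdeg_in_leX d k P : mdeg_in_le d P -> mdeg_in_le (k * d)%N (P ^+ k).
Proof.
move=> hP; elim: k => [|k IH]; last by rewrite exprS mulSn; apply: mdeg_in_leM.
by move=> m; rewrite expr0 msupp1 inE => /eqP ->; rewrite mnm0E.
Qed.

Lemma mdeg_in_le_sum (I : eqType) (s : seq I) (f : I -> {mpoly R[n]}) d :
  {in s, forall j, mdeg_in_le d (f j)} -> mdeg_in_le d (\sum_(j <- s) f j).
Proof.
move=> h; rewrite big_seq; elim/big_ind: _ => //; last exact: mdeg_in_leD.
by move=> m; rewrite msupp0.
Qed.

Lemma mdeg_in_le_t_poly k d P : (0 < k)%N ->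
  mdeg_in_le d P -> mdeg_in_le (k * d)%N (t_poly k P).
Proof.
move=> k0 h; apply: mdeg_in_leD; first exact: mdeg_in_leX.
by apply: mdeg_in_leN; apply: mdeg_in_leW h _; rewrite leq_pmull.
Qed.

Lemma mdeg_in_le_var (j : 'I_n) : mdeg_in_le (j == i) 'X_j.
Proof. by move=> m; rewrite msuppX inE => /eqP ->; rewrite mnm1E. Qed.

End DegreeBound.

(** [g_i] has degree at most [(i + 1) q] in [X], and [t_q(Y)], [t_q(Z)] occur to powers at most
    [q - 1], so the sum has degree at most [q (q - 1)] in each variable. *)
Lemma T_poly_reduced (F : finFieldType) q : (1 < q)%N -> #|F| = (q ^ 2)%N ->
  is_reduced (T_poly F q).
Proof.
move=> q1 cF m mT i; rewrite cF.
have q2 : ((q ^ 2).-1.+1 = q ^ 2)%N by rewrite prednK // expn_gt0; lia.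
rewrite -q2 ltnS; move: m mT; rewrite -/(mdeg_in_le i _ _).
have hX := @mdeg_in_le_var 3 F i (inord 0).
have hY := @mdeg_in_le_var 3 F i (inord 1).
have hZ := @mdeg_in_le_var 3 F i (inord 2).
(* At most one of the three indicators is true, so one computation bounds all three partial
   degrees. *)
have b : ((inord 0 == i) + (inord 1 == i) + (inord 2 == i) <= 1)%N.
  rewrite -!val_eqE /= !inordK //; case: i {hX hY hZ} => [[|[|[|]]]] //.
move: (inord 0 == i) (inord 1 == i) (inord 2 == i) hX hY hZ b =>
  b0 b1 b2 hX hY hZ b.
rewrite -/(varX F) -/(varY F) -/(varZ F) in hX hY hZ.
have tY := mdeg_in_le_t_poly (ltnW q1) hY.
have tZ := mdeg_in_le_t_poly (ltnW q1) hZ.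
have h0 : (0 < (q ^ 2 + 1) %/ 2)%N by rewrite divn_gt0 //; nia.
apply: mdeg_in_leD; first apply: mdeg_in_leD; first apply: mdeg_in_leD.
- by apply: mdeg_in_leW (mdeg_in_leM hX hY) _; nia.
- apply/mdeg_in_leN/mdeg_in_leZ.
  apply: mdeg_in_leW (mdeg_in_leM (mdeg_in_le_t_poly h0 hX) tY) _.
  have : (2 * ((q ^ 2 + 1) %/ 2) <= q ^ 2 + 1)%N by rewrite mulnC leq_divM.
  by case: (b0) (b1) b => -[] //= _; nia.
- by apply: mdeg_in_leW hZ _; case: (b2); nia.
apply/mdeg_in_leN/mdeg_in_le_sum => j; rewrite mem_index_iota => /andP[_ jq].
have hg : mdeg_in_le i (q * (q - 1) * b0)%N (g_poly F q j).
  apply/mdeg_in_leZ/mdeg_in_le_sum => l; rewrite mem_index_iota => /andP[_ lj].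
  apply/mdeg_in_leZ; apply: mdeg_in_leW (mdeg_in_leX hX) _.
  by rewrite leq_mul2r; apply/orP; right; nia.
have := mdeg_in_leM (mdeg_in_leM hg (mdeg_in_leX (k := j.+1) tY))
  (mdeg_in_leX (k := q - j.+1) tZ).
move/mdeg_in_leW; apply.
by case: (b0) (b1) (b2) b => -[] [] //= _; nia.
Qed.

Lemma eval3_T (F : finFieldType) q (x y z : F) :
  eval3 (T_poly F q) x y z =
    x * y - 2%:R^-1 * ((x ^+ ((q ^ 2 + 1) %/ 2) - x) * (y ^+ q - y)) + z
    - \sum_(0 <= i < q - 1)
       ((- 4%:R) ^- i.+1 *
         \sum_(0 <= j < i.+2)
           (catalan (j * (q - 1) + i))%:R * x ^+ (j * (q - 1) + i + 1))
       * (y ^+ q - y) ^+ i.+1 * (z ^+ q - z) ^+ (q - i.+1).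
Proof.
rewrite /eval3; set v := tnth _.
have vX : (varX F).@[v] = x by rewrite mevalXU /v (tnth_nth 0) inordK.
have vY : (varY F).@[v] = y by rewrite mevalXU /v (tnth_nth 0) inordK.
have vZ : (varZ F).@[v] = z by rewrite mevalXU /v (tnth_nth 0) inordK.
have vt n P : (t_poly n P).@[v] = P.@[v] ^+ n - P.@[v].
  by rewrite mevalB rmorphXn.
rewrite /T_poly mevalB mevalD mevalB mevalM mevalZ mevalM !vt vX vY vZ.
congr (_ - _); rewrite rmorph_sum; apply: eq_bigr => i _ /=.
rewrite !mevalM mevalZ rmorph_sum !rmorphXn /= !vt vY vZ; congr (_ * _ * _ * _).
by apply: eq_bigr => j _; rewrite /= mevalZ rmorphXn /= vX.
Qed.


(** * The Hughes ternary operation *)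

(* By finiteness the existence halves of (C), (D) and (E) follow from the
   uniqueness halves, and uniqueness in (E) is that of (C) read dually. *)
Lemma is_ptr_of_injective (F : finFieldType) (tau : F -> F -> F -> F) :
    (forall a b z, tau a 0 z = z /\ tau 0 b z = z) ->
    (forall x y, tau x 1 0 = x /\ tau 1 y 0 = y) ->
    (forall a b, injective (tau a b)) ->
    (forall a c b d x x', a <> c -> tau x a b = tau x c d ->
       tau x' a b = tau x' c d -> x = x') ->
  is_ptr tau.
Proof.
move=> hA hB injD uniqC; split=> //.
- move=> a c ac b d.
  (* [f x] is the intercept that makes the line of slope [c] meet the first line at abscissa [x];
     [uniqC] makes [f] injective, hence onto. *)
  pose f x := invF (injD x c) (tau x a b).
  have fE x : tau x c (f x) = tau x a b by rewrite /f f_invF.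
  have injf : injective f.
    by move=> x x' e; apply: (uniqC a c b (f x)); rewrite // ?fE // e fE.
  have [g _ gf] := injF_bij injf.
  exists (g d); split=> [|x ex]; first by rewrite -fE gf.
  by apply: (uniqC a c b d) => //; rewrite -fE gf.
- move=> a b c; exists (invF (injD a b) c); split=> [|z <-]; first exact: f_invF.
  exact: invF_f.
move=> a c ac b d.
(* Two pairs with the same image are lines sharing points at both abscissas [a] and [c]: different
   slopes contradict [uniqC], equal slopes give equal intercepts by [injD]. *)
pose f (yz : F * F) := (tau a yz.1 yz.2, tau c yz.1 yz.2).
have injf : injective f.
  move=> [y z] [y' z'] [/= ea ec].
  have [ey|/eqP ny] := eqVneq y y'; last by case: ac; apply: (uniqC y y' z z').
  by rewrite ey in ea *; rewrite (injD _ _ _ _ ea).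
have [g gf fg] := injF_bij injf.
exists (g (b, d)); split=> [|yz [e1 e2]]; first by case: (fg (b, d)).
by rewrite -(gf yz) /f e1 e2.
Qed.

Lemma eq_by_sub (V : zmodType) (x y u v : V) : x = y -> u - v = x - y -> u = v.
Proof. by move=> ->; rewrite subrr; apply: subr0_eq. Qed.

Section Hughes.

Variables (p e q r : nat) (F : finFieldType) (K : {set F}).
Hypotheses (pF : p \in [pchar F]) (op : odd p) (qE : q = (p ^ e)%N)
  (qr : q = r.*2.+1) (r_gt0 : (0 < r)%N)
  (card_F : #|F| = (q ^ 2)%N)
  (K_subfield : GRing.divring_closed (mem K)) (card_K : #|K| = q).

Let n2 : 2%:R != 0 :> F := natr2_neq0 pF op.
Let oq : odd q. Proof. by rewrite qr /= odd_double. Qed.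
Let cF : #|F| = (2 * r * r.+1).*2.+1.
Proof. by rewrite card_F qr; nia. Qed.

(** * The subfield K and conjugation over it *)

Lemma expfqD (x y : F) : (x + y) ^+ q = x ^+ q + y ^+ q.
Proof.
apply: exprDn_pchar; rewrite qE pnatX.
by rewrite (eq_pnat _ (pcharf_eq pF)) pnat_id ?(pcharf_prime pF).
Qed.

Lemma expfqN (x : F) : (- x) ^+ q = - x ^+ q.
Proof. by rewrite exprNn -signr_odd oq mulN1r. Qed.

Lemma expfqB (x y : F) : (x - y) ^+ q = x ^+ q - y ^+ q.
Proof. by rewrite expfqD expfqN. Qed.

Lemma expfqq (x : F) : x ^+ q ^+ q = x.
Proof. by rewrite -exprM mulnn -card_F expf_card. Qed.

(** Multiplication by a nonzero [y] of [K] permutes the nonzero elements of [K], so [y^(q-1) = 1];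
    conversely [X^q - X] has at most [q] roots, and [K] already supplies them. *)
Lemma subfield_fixed (x : F) : (x \in K) = (x ^+ q == x).
Proof.
have [K1 KB Kdiv] := K_subfield.
have K0 : 0 \in K by rewrite -(subrr 1); apply: KB.
have fixK y : y \in K -> y ^+ q = y.
  have [->|y0] := eqVneq y 0 => yK; first by rewrite expr0n qr.
  pose P := \prod_(z in K :\ 0) z.
  have P0 : P != 0.
    by apply/prodf_neq0 => z; rewrite !inE => /andP[].
  have : y ^+ #|K :\ 0| * P = 1 * P.
    rewrite -prodr_const -big_split mul1r /P [RHS](reindex_inj (mulfI y0)).
    apply: eq_bigl => z; rewrite !inE mulf_eq0 (negPf y0) /=; congr (_ && _).
    apply/idP/idP => [zK|yzK]; last by rewrite -(mulKf y0 z) mulrC; apply: Kdiv.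
    by rewrite -[z]invrK; apply: (Kdiv) => //; rewrite -div1r; apply: Kdiv.
  have := cardsD1 0 K; rewrite K0 card_K add1n => ->.
  by move=> /(mulIf P0) yq; rewrite exprS yq mulr1.
pose S := [set y : F | y ^+ q == y].
have KS : K \subset S by apply/subsetP => y yK; rewrite inE fixK.
have cS : (#|S| <= #|K|)%N.
  have sz : size ('X^q - 'X : {poly F}) = q.+1.
    by rewrite size_polyDl ?size_polyXn // size_polyN size_polyX qr;
      case: (r) r_gt0.
  rewrite card_K -ltnS -sz cardE; apply: max_poly_roots (enum_uniq _).
    by rewrite -size_poly_gt0 sz.
  apply/allP => y; rewrite mem_enum inE => /eqP yq.
  by rewrite rootE !hornerE yq subrr.
have -> : K = S by apply/eqP; rewrite eqEcard KS.
by rewrite inE.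
Qed.

Lemma subfield_expfq (x : F) : x \in K -> x ^+ q = x.
Proof. by rewrite subfield_fixed => /eqP. Qed.

Lemma subfield0 : 0 \in K.
Proof. by rewrite subfield_fixed expr0n qr. Qed.

Lemma subfieldB (x y : F) : x \in K -> y \in K -> x - y \in K.
Proof. by case: K_subfield => _ KB _; apply: KB. Qed.

(** [(Q - 1) / 2] is a multiple of [q - 1], so Euler's criterion holds for the nonzero elements of
    [K]. *)
Lemma subfield_is_sq (x : F) : x \in K -> is_sq x.
Proof.
have [->|x0] := eqVneq x 0 => xK; first exact: is_sq0.
have e1 : x ^+ (2 * r) = 1.
  apply: (mulfI x0); rewrite mulr1 -exprS mul2n -qr; exact: subfield_expfq.
by rewrite (is_sqE n2 cF) exprM e1 expr1n -addr_eq0.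
Qed.

Lemma subfield_indep (b k l : F) : b \notin K -> k \in K -> l \in K ->
  k * b + l = 0 -> k = 0 /\ l = 0.
Proof.
move=> bK kK lK; have [->|k0] := eqVneq k 0; first by rewrite mul0r add0r.
move/eqP; rewrite addr_eq0 => /eqP kb.
case/negP: bK; rewrite -(mulKf k0 b) kb mulrC mulNr -mulrN.
have [_ _ Kdiv] := K_subfield; rewrite mulrN -mulNr; apply: Kdiv => //.
by rewrite -[- l]sub0r subfieldB ?subfield0.
Qed.

Lemma subfield_coords (y z : F) : y \notin K ->
  exists k k', [/\ k \in K, k' \in K & z = k * y + k'].
Proof.
move=> yK; have ty : y ^+ q - y != 0 by rewrite subr_eq0 -subfield_fixed.
(* Applying [t_q] to [z = k y + k'] forces this [k]; conjugation negates its numerator and its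
   denominator, so it lies in [K]. *)
pose k := (z ^+ q - z) / (y ^+ q - y).
have kq : k ^+ q = k.
  rewrite exprMn exprVn !expfqB !expfqq -(opprB _ z) -(opprB _ y) invrN mulrNN.
  by [].
exists k, (z - k * y); split; last by rewrite addrC subrK.
  by rewrite subfield_fixed kq.
rewrite subfield_fixed expfqB exprMn kq subr_eq -addrA [- _ + _]addrC -mulrBr.
by rewrite divfK // addrC subrK.
Qed.

(** * The nearfield product expressed by conjugation *)

Definition frob_if (b : bool) (y : F) : F := if b then y ^+ q else y.

Lemma nearfield_mulE (x y : F) :
  nearfield_mul q x y = x * frob_if (~~ is_sq x) y.
Proof. by rewrite /nearfield_mul -/(is_sq x); case: is_sq. Qed.

Lemma frob_ifB b (x y : F) : frob_if b (x - y) = frob_if b x - frob_if b y.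
Proof. by case: b => //=; apply: expfqB. Qed.

Lemma frob_if_notin b (y : F) : (frob_if b y \in K) = (y \in K).
Proof.
by case: b => //=; rewrite !subfield_fixed expfqq eq_sym.
Qed.

Lemma is_sq_frob b (y : F) : is_sq (frob_if b y) = is_sq y.
Proof. by case: b => //=; apply: (is_sq_expf_odd n2 cF). Qed.

Lemma hughes_in (x y z : F) : y \in K -> hughes_ptr q K x y z = x * y + z.
Proof.
move=> yK; rewrite /hughes_ptr yK nearfield_mulE.
by case: is_sq => //=; rewrite subfield_expfq.
Qed.

Lemma hughes_notin (x y k k' : F) : y \notin K -> k \in K -> k' \in K ->
  hughes_ptr q K x y (k * y + k') = (x + k) * frob_if (~~ is_sq (x + k)) y + k'.
Proof.
move=> yK kK kK'; rewrite /hughes_ptr (negPf yK).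
case: pickP => [[l l'] /= /and3P[lK lK' /eqP el]|/(_ (k, k'))]; last first.
  by rewrite kK kK' eqxx.
have [|||/eqP e1 /eqP e2] := @subfield_indep y (k - l) (k' - l') yK.
- exact: subfieldB.
- exact: subfieldB.
- have -> : (k - l) * y + (k' - l') = (k * y + k') - (l * y + l') by ring.
  by rewrite el subrr.
move: e1 e2; rewrite !subr_eq0 => /eqP <- /eqP <-.
by rewrite nearfield_mulE.
Qed.

Lemma hughes_meet (x k k' l l' a c : F) :
    (x + k) * a + k' = (x + l) * c + l' ->
  (x + k) * (a - c) = (l - k) * c + (l' - k') /\
  (x + l) * (a - c) = (l - k) * a + (l' - k').
Proof.
by move=> E; split; apply: (eq_by_sub E); ring.
Qed.

Lemma frob_ifK b y : frob_if b (frob_if b y) = y.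
Proof. by case: b => //=; apply: expfqq. Qed.

Lemma frob_if_sub b (x : F) : x \in K -> frob_if b x = x.
Proof. by case: b => //= xK; apply: subfield_expfq. Qed.

Lemma frob_if_affine b (k l y : F) : k \in K -> l \in K ->
  frob_if b (k * y + l) = k * frob_if b y + l.
Proof.
by case: b => //= kK lK;
  rewrite expfqD exprMn (subfield_expfq kK) (subfield_expfq lK).
Qed.

Lemma is_sqMl (x y d : F) : d != 0 -> x != 0 -> y != 0 ->
  (is_sq (x * d) == is_sq (y * d)) = (is_sq x == is_sq y).
Proof.
by move=> d0 x0 y0; rewrite !(is_sqM n2 cF) //; do 3 case: is_sq.
Qed.

(** Let [z] and [z'] have coordinates [k, k'] and [l, l']. If [a + k] and [a + l] have the same
    character, independence of [b] and 1 over [K] gives equality. Otherwise their multiples by one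
    common nonzero factor are conjugate, hence of equal character, which is absurd unless one of
    them is 0; then independence again applies. *)
Lemma hughes_inj (a b : F) : injective (hughes_ptr q K a b).
Proof.
have [bK z z'|bK z z'] := boolP (b \in K).
  by rewrite !hughes_in // => /addrI.
have [k [k' [kK kK' ->]]] := subfield_coords z bK.
have [l [l' [lK lK' ->]]] := subfield_coords z' bK.
rewrite !hughes_notin //; set s := ~~ is_sq (a + k); set t := ~~ is_sq (a + l).
have lkK : l - k \in K by apply: subfieldB.
have lkK' : l' - k' \in K by apply: subfieldB.
move=> /hughes_meet[ek el].
have [est|nst] := eqVneq s t.
  rewrite est subrr mulr0 in ek.
  have /subfield_indep := esym ek; rewrite frob_if_notin => /(_ bK lkK lkK').
  by case=> /eqP + /eqP; rewrite !subr_eq0 => /eqP -> /eqP ->.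
have ts : frob_if true (frob_if t b) = frob_if s b.
  by case: (s) (t) nst => -[] //= _; apply: expfqq.
have d0 : frob_if s b - frob_if t b != 0.
  rewrite subr_eq0 -ts /= -subfield_fixed frob_if_notin //.
have := is_sq_frob true ((l - k) * frob_if t b + (l' - k')).
rewrite frob_if_affine // ts -ek -el.
have [ak|ak] := eqVneq (a + k) 0.
  move: ek; rewrite ak mul0r => /esym /subfield_indep.
  rewrite frob_if_notin => /(_ bK lkK lkK').
  by case=> /eqP + /eqP; rewrite !subr_eq0 => /eqP -> /eqP ->.
have [al|al] := eqVneq (a + l) 0.
  move: el; rewrite al mul0r => /esym /subfield_indep.
  rewrite frob_if_notin => /(_ bK lkK lkK').
  by case=> /eqP + /eqP; rewrite !subr_eq0 => /eqP -> /eqP ->.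
move/(introT eqP); rewrite is_sqMl // => /eqP ss.
by rewrite /s /t ss eqxx in nst.
Qed.

(** The character of a product with [w] determines that of the left factor, so both products use the
    same branch. *)
Lemma nearfield_mulIf (w x x' : F) : w != 0 ->
  nearfield_mul q x w = nearfield_mul q x' w -> x = x'.
Proof.
move=> w0; rewrite !nearfield_mulE.
have fw0 b : frob_if b w != 0 by case: b => //=; rewrite expf_neq0.
have [->|x0] := eqVneq x 0.
  by rewrite mul0r => /esym/eqP; rewrite mulf_eq0 (negPf (fw0 _)) orbF => /eqP.
have [->|x'0] := eqVneq x' 0.
  by rewrite mul0r => /eqP; rewrite mulf_eq0 (negPf (fw0 _)) orbF => /eqP.
move=> E; have := congr1 (@is_sq F) E; rewrite !(is_sqM n2 cF) // !is_sq_frob.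
move=> ss; have {}ss : is_sq x = is_sq x' by move: ss; do 3 case: is_sq.
by move: E; rewrite ss; apply: mulIf.
Qed.

(** Conjugation fixes [a], so the incidence equation collects into a nearfield product of [x + k]
    with [c - a], whose value does not depend on [x]. *)
Lemma hughes_meet_mixed (a b c d x x' : F) : a \in K -> c \notin K ->
  hughes_ptr q K x a b = hughes_ptr q K x c d ->
  hughes_ptr q K x' a b = hughes_ptr q K x' c d -> x = x'.
Proof.
move=> aK cK; have [k [k' [kK kK' ->]]] := subfield_coords d cK.
rewrite !(hughes_in _ _ aK) !hughes_notin // => E1 E2.
have E y : y * a + b = (y + k) * frob_if (~~ is_sq (y + k)) c + k' ->
    nearfield_mul q (y + k) (c - a) = b - k' - k * a.
  rewrite nearfield_mulE frob_ifB [frob_if _ a]frob_if_sub // => /esym ey.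
  by apply: (eq_by_sub ey); ring.
apply: (addIr k); apply: (@nearfield_mulIf (c - a)); last by rewrite !E.
by rewrite subr_eq0; apply: contraNneq cK => ->.
Qed.

Section NonRational.

Variables (a c k k' l l' : F).
Hypotheses (ac : a <> c) (aK : a \notin K) (cK : c \notin K)
  (kK : k \in K) (kK' : k' \in K) (lK : l \in K) (lK' : l' \in K).

Let A := (l - k) * a + (l' - k').
Let C := (l - k) * c + (l' - k').

(** If [D] were 0, so would be the conjugate of [C]; independence then gives [l = k], hence [s = t],
    and [D = 0] becomes [a = c]. *)
Lemma hughes_meet_frob (x : F) (s := ~~ is_sq (x + k)) (t := ~~ is_sq (x + l))
    (D := frob_if s a - frob_if t c) :
    hughes_ptr q K x a (k * a + k') = hughes_ptr q K x c (l * c + l') ->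
  [/\ D != 0, (x + k) * D = frob_if t C & (x + l) * D = frob_if s A].
Proof.
have lkK : l - k \in K by apply: subfieldB.
have lkK' : l' - k' \in K by apply: subfieldB.
rewrite !hughes_notin // => /hughes_meet[ek el].
rewrite !frob_if_affine //; split=> //.
apply/eqP => D0; move: ek; rewrite -/s -/t -/D D0 mulr0 => /esym/subfield_indep.
rewrite frob_if_notin => /(_ cK lkK lkK') [/eqP kl _].
case: ac; apply: subr0_eq; rewrite -(frob_ifK s (a - c)) frob_ifB.
move: D0; rewrite /D; have -> : t = s by rewrite /t; move: kl;
  rewrite subr_eq0 => /eqP ->.
by move=> ->; case: (s); rewrite //= expr0n qr.
Qed.

(* With a*, c* either the elements a, c or their conjugates according to the
   characters of x + k and x + l, the incidence equation solves as
   (x + k)(a* - c* ) = C* and (x + l)(a* - c* ) = A*.  So the product of the two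
   characters is that of AC, whatever x is: for two solutions, the characters
   either agree, giving equal x, or both differ, making x' + k conjugate to
   x + k, which has the same character. *)
Lemma hughes_meet_notin (x x' : F) :
  hughes_ptr q K x a (k * a + k') = hughes_ptr q K x c (l * c + l') ->
  hughes_ptr q K x' a (k * a + k') = hughes_ptr q K x' c (l * c + l') -> x = x'.
Proof.
have lkK : l - k \in K by apply: subfieldB.
have lkK' : l' - k' \in K by apply: subfieldB.
move=> /hughes_meet_frob[D0 ek el] /hughes_meet_frob[D0' ek' el'].
have f0 b : frob_if b 0 = 0 :> F by case: b; rewrite //= expr0n qr.
(* Equal coordinates give [C = 0], so both solutions are [- k]; in the other case [A] and [C] are
   nonzero and have multiplicative characters. *)
have [lk|lk] := boolP ((l - k == 0) && (l' - k' == 0)).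
  have C0 : C = 0 by case/andP: lk => /eqP + /eqP; rewrite /C => -> ->;
    rewrite mul0r addr0.
  apply: (addIr k); apply: (etrans (y := 0)); first by apply: (mulIf D0);
    rewrite ek C0 f0 mul0r.
  by apply: (mulIf D0'); rewrite ek' C0 f0 mul0r.
have nz (y : F) b : y \notin K -> frob_if b ((l - k) * y + (l' - k')) != 0.
  move=> yK; rewrite frob_if_affine //; apply: contra lk => /eqP/subfield_indep.
  by rewrite frob_if_notin => /(_ yK lkK lkK') [-> ->]; rewrite eqxx.
have parity (y D : F) s t : D != 0 -> (y + k) * D = frob_if t C ->
    (y + l) * D = frob_if s A -> (is_sq (y + k) == is_sq (y + l)) =
      (is_sq A == is_sq C).
  move=> d0 eC eA; rewrite -(@is_sqMl _ _ D) //.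
  - by rewrite eC eA !is_sq_frob eq_sym.
  - by apply: contraNneq (nz c t cK) => y0; rewrite -/C -eC y0 mul0r.
  - by apply: contraNneq (nz a s aK) => y0; rewrite -/A -eA y0 mul0r.
have := parity _ _ _ _ D0' ek' el'; rewrite -(parity _ _ _ _ D0 ek el) => par.
have [sk|sk] := eqVneq (is_sq (x' + k)) (is_sq (x + k)).
  have sl : is_sq (x' + l) = is_sq (x + l) by move: par; rewrite sk;
    do 3 case: is_sq.
  by apply: (addIr k); apply: (mulIf D0); rewrite ek -sl -ek' sk.
have sl : is_sq (x' + l) = ~~ is_sq (x + l) by move: par sk; do 4 case: is_sq.
have {}sk : is_sq (x' + k) = ~~ is_sq (x + k) by move: sk; do 2 case: is_sq.
have flip b y : frob_if (~~ b) y = frob_if b y ^+ q by case: b => //=;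
  rewrite expfqq.
have : x' + k = (x + k) ^+ q.
  by apply: (mulIf D0'); rewrite ek' sk sl !(flip (~~ is_sq _)) -expfqB -exprMn ek.
move/(congr1 (@is_sq F)); rewrite (is_sq_frob true) sk.
by case: is_sq.
Qed.

End NonRational.

Lemma hughes_meet_unique (a b c d x x' : F) : a <> c ->
  hughes_ptr q K x a b = hughes_ptr q K x c d ->
  hughes_ptr q K x' a b = hughes_ptr q K x' c d -> x = x'.
Proof.
move=> ac; have [aK|aK] := boolP (a \in K); have [cK|cK] := boolP (c \in K).
- rewrite !hughes_in // => E1 E2.
  have ac0 : a - c != 0 by rewrite subr_eq0; apply/eqP.
  have E y : y * a + b = y * c + d -> y * (a - c) = d - b.
    by move=> ey; apply: (eq_by_sub ey); ring.
  by apply: (mulIf ac0); rewrite !E.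
- exact: hughes_meet_mixed.
- by move=> E1 E2; apply: (@hughes_meet_mixed c d a b) => //; apply: esym.
have [k [k' [kK kK' ->]]] := subfield_coords b aK.
have [l [l' [lK lK' ->]]] := subfield_coords d cK.
exact: hughes_meet_notin.
Qed.

(** Elements of [K] are squares, so for [x = 0], and for [x = 1] with [z = 0], the nearfield product
    is the ordinary one; this gives (A) and (B). *)
Lemma hughes_is_ptr tau :
  (forall x y z, tau x y z = hughes_ptr q K x y z) -> is_ptr tau.
Proof.
move=> tauE; have K0 := subfield0; have [K1 _ _] := K_subfield.
apply: is_ptr_of_injective.
- move=> a b z; rewrite !tauE hughes_in // mulr0 add0r; split=> //.
  have [bK|bK] := boolP (b \in K); first by rewrite hughes_in // mul0r add0r.
  have [k [k' [kK kK' ->]]] := subfield_coords z bK.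
  by rewrite hughes_notin // add0r subfield_is_sq.
- move=> x y; rewrite !tauE hughes_in // mulr1 addr0; split=> //.
  have [yK|yK] := boolP (y \in K); first by rewrite hughes_in // mul1r addr0.
  have -> : 0 = 0 * y + 0 :> F by rewrite mul0r addr0.
  by rewrite hughes_notin // !addr0 subfield_is_sq // mul1r.
- by move=> a b z z'; rewrite !tauE; apply: hughes_inj.
by move=> a c b d x x' ac; rewrite !tauE; apply: hughes_meet_unique.
Qed.

(** * The values of T are those of the Hughes operation *)

Lemma eval3_T_hughes (x y z : F) :
  eval3 (T_poly F q) x y z = hughes_ptr q K x y z.
Proof.
rewrite eval3_T.
have [yK|yK] := boolP (y \in K).
  have t0 : y ^+ q - y = 0 by apply/eqP; rewrite subr_eq0 -subfield_fixed.
  rewrite t0 !mulr0 subr0 big1 ?subr0 ?hughes_in // => i _.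
  by rewrite expr0n mulr0 mul0r.
have [k [k' [kK kK' ->]]] := subfield_coords z yK.
rewrite hughes_notin //.
set t := y ^+ q - y; set h := (_ %/ 2)%N.
have kq := subfield_expfq kK.
have tz : (k * y + k') ^+ q - (k * y + k') = k * t.
  by rewrite expfqD exprMn kq subfield_expfq // /t; ring.
have tq : t ^+ q = - t by rewrite expfqB expfqq opprB.
have hE : h = (r.+1 * (q - 1)).+1 by rewrite /h; nia.
rewrite tz.
have -> : \sum_(0 <= i < q - 1)
     (- 4%:R) ^- i.+1 * (\sum_(0 <= j < i.+2)
       (catalan (j * (q - 1) + i))%:R * x ^+ (j * (q - 1) + i + 1)) *
     t ^+ i.+1 * (k * t) ^+ (q - i.+1)
  = 2%:R^-1 * t * ((x + k) ^+ h - x ^+ h - k).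
  have q1 : (0 < q - 1)%N by lia.
  have kq1 : k ^+ (q - 1).+1 = k by rewrite -[RHS]kq; congr (_ ^+ _); lia.
  rewrite hE -(@sum_bin_shift F (q - 1)%N r x k q1 kq1) mulr_sumr;
    apply: eq_big_nat => i /andP[_ iq].
  rewrite (sum_catalan_half_bin pF op qE qr iq).
  have te : t ^+ i.+1 * t ^+ (q - i.+1) = - t.
    by rewrite -exprD -tq; congr (_ ^+ _); lia.
  have -> : (q - 1 - i = q - i.+1)%N by lia.
  set S := \sum_(0 <= j < _) _.
  transitivity (- 2%:R^-1 * S * k ^+ (q - i.+1) * (t ^+ i.+1 * t ^+ (q - i.+1))).
    by rewrite exprMn; ring.
  by rewrite te; ring.
(* The terms in [x^h] from [M] and from the sum cancel, so only the character of [x + k] needs a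
   case distinction. *)
have -> : h = (2 * r * r.+1).+1 by rewrite hE; nia.
rewrite !(expf_half_succ n2 cF).
by case: (is_sq (x + k)); rewrite /= /t; field.
Qed.

End Hughes.

Theorem theorem2 (p e q : nat) (F : finFieldType) (K : {set F})
    (p_prime : prime p) (p_odd : odd p) (e_gt0 : (0 < e)%N)
    (q_def : q = (p ^ e)%N) (card_F : #|F| = (q ^ 2)%N)
    (K_subfield : GRing.divring_closed (mem K)) (card_K : #|K| = q) :
  is_reduced (T_poly F q) /\ is_hughes_ptr_poly q K (T_poly F q).
Proof.
have pF : p \in [pchar F].
  by apply: (card_finPcharP (n := e * 2)) => //; rewrite card_F q_def expnM.
have q1 : (1 < q)%N by rewrite q_def -(exp1n e) ltn_exp2r // prime_gt1.
have q_odd : odd q by rewrite q_def oddX p_odd orbT.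
pose r := q./2.
have qr : q = r.*2.+1 by rewrite -[LHS]odd_double_half q_odd.
have r0 : (0 < r)%N by lia.
have T_hughes := eval3_T_hughes pF p_odd q_def qr r0 card_F K_subfield card_K.
split; first exact: T_poly_reduced.
split.
  exact: (hughes_is_ptr pF p_odd q_def qr r0 card_F K_subfield card_K).
(* The two ternary operations agree pointwise, so the identity on points is an isomorphism. *)
exists id; split; first by exists id.
have -> : ptr_lines (eval3 (T_poly F q)) = hughes_lines q K.
  congr (_ |: (_ :|: _)); apply: eq_imset => mk; congr (_ |: _).
  by apply: eq_imset => x; rewrite T_hughes.
rewrite -[LHS]imset_id; apply: eq_imset => l.
by rewrite imset_id.
Qed.
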